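(* Every group can be embedded into a logically perfect group (with respect to the variety $\Theta$ of all groups).
   Context: Let $\Theta$ be the variety of all groups. Let $X^0$ be an infinite set of variables; $X, Y$ below always denote finite subsets of $X^0$, and $W(X)$ is the free group over $X$. For a group $H$, the elements of the set $\mathrm{Hom}(W(X),H)$ of all homomorphisms $W(X)\to H$ are called points. Formulas. The sets $\Upsilon_X$ of formal expressions (for all finite $X\subset X^0$) are defined simultaneously by induction: each equality $w\equiv w'$ with $w,w'\in W(X)$ is in $\Upsilon_X$; if $u,v\in\Upsilon_X$ and $x\in X$, then $u\vee v$, $u\wedge v$, $\neg u$, $\exists x\,u$ are in $\Upsilon_X$; if $s:W(Y)\to W(X)$ is a homomorphism and $u\in\Upsilon_Y$, then $s_*u\in\Upsilon_X$. For $H\in\Theta$ the value $\mathrm{Val}^X_H(u)\subset \mathrm{Hom}(W(X),H)$ of $u\in\Upsilon_X$ is defined by: $\mathrm{Val}^X_H(w\equiv w')=\{\mu : \mu(w)=\mu(w')\}$; $\vee,\wedge,\neg$ are interpreted as union, intersection, complement; $\mu\in \mathrm{Val}^X_H(\exists x\,u)$ iff there is $\nu\in \mathrm{Val}^X_H(u)$ with $\mu(x')=\nu(x')$ for all $x'\in X$, $x'\ne x$; $\mu\in \mathrm{Val}^X_H(s_*u)$ iff $\mu\circ s\in \mathrm{Val}^Y_H(u)$. The algebra of formulas $\Phi(X)$ is the quotient of $\Upsilon_X$ identifying $u$ and $v$ when $\mathrm{Val}^X_H(u)=\mathrm{Val}^X_H(v)$ for all $H\in\Theta$; it is a Boolean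 algebra and $\mathrm{Val}^X_H$ is well defined on it. The logical kernel of a point $\mu:W(X)\to H$ is $\mathrm{LKer}(\mu)=\{u\in\Phi(X) : \mu\in \mathrm{Val}^X_H(u)\}$. $\mathrm{Aut}(H)$ acts on $\mathrm{Hom}(W(X),H)$ by $\mu\mapsto\mu\sigma$, where $(\mu\sigma)(w)=\sigma(\mu(w))$. The group $H$ is logically perfect if for every finite $X$ and all points $\mu,\nu:W(X)\to H$ one has $\mathrm{LKer}(\mu)=\mathrm{LKer}(\nu)$ if and only if $\mu\sigma=\nu$ for some $\sigma\in \mathrm{Aut}(H)$. *)

(* Defs.v *)
From HB Require Import structures.
From mathcomp Require Import all_boot finmap.
From mathcomp Require Import boolp classical_sets cardinality.

Set Implicit Arguments.
Unset Strict Implicit.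
Unset Printing Implicit Defensive.

Local Open Scope group_scope.

Notation hom := UMagmaMorphism.type.

(* The free group on T is realized as the set of freely reduced words.  The
   letter (x, true) stands for x and (x, false) for x^-1. *)
Section ReducedWords.
Variable T : choiceType.
Implicit Types (a : T * bool) (u v w : seq (T * bool)).

Definition inv_letter a : T * bool := (a.1, ~~ a.2).

Fixpoint reduced w : bool :=
  if w is a :: w' then
    (if w' is b :: _ then b != inv_letter a else true) && reduced w'
  else true.

Definition cons_letter a w : seq (T * bool) :=
  if w is b :: w' then if b == inv_letter a then w' else a :: w else [:: a].

Definition mul_word u v : seq (T * bool) := foldr cons_letter v u.

Definition inv_word w : seq (T * bool) := rev (map inv_letter w).

Lemma inv_letterK : involutive inv_letter.
Proof. by case=> x b; rewrite /inv_letter /= negbK. Qed.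

Lemma reduced_behead a w : reduced (a :: w) -> reduced w.
Proof. by move=> /= /andP[]. Qed.

Lemma cons_letter_reduced a w : reduced w -> reduced (cons_letter a w).
Proof.
case: w => [//|b w] rw; rewrite /cons_letter.
case: (eqVneq b (inv_letter a)) => [_|ne]; first exact: reduced_behead rw.
by move: rw => /= ->; rewrite ne.
Qed.

Lemma cons_letterK a w :
  reduced w -> cons_letter (inv_letter a) (cons_letter a w) = w.
Proof.
case: w => [|b w] rw /=; first by rewrite inv_letterK eqxx.
case: (eqVneq b (inv_letter a)) => [eb|ne] /=; last by rewrite inv_letterK eqxx.
case: w rw => [_|c w] /=; first by rewrite eb.
by case/andP => ne _; rewrite -eb (negPf ne).
Qed.

Lemma mul_word_reduced u v : reduced v -> reduced (mul_word u v).
Proof. by move=> rv; elim: u => //= a u; apply: cons_letter_reduced. Qed.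

Lemma mul_cons_letter a u v : reduced u -> reduced v ->
  mul_word (cons_letter a u) v = cons_letter a (mul_word u v).
Proof.
case: u => [//|b u] ru rv; rewrite /cons_letter -/(cons_letter _ _).
case: (eqVneq b (inv_letter a)) => [->|//] /=.
have := cons_letterK (inv_letter a) (mul_word_reduced u rv).
by rewrite inv_letterK => ->.
Qed.

Lemma mul_wordA u v w : reduced v -> reduced w ->
  mul_word u (mul_word v w) = mul_word (mul_word u v) w.
Proof.
move=> rv rw; elim: u => //= a u IHu.
by rewrite mul_cons_letter ?IHu // mul_word_reduced.
Qed.

Lemma mul_word1 u : reduced u -> mul_word u [::] = u.
Proof.
elim: u => //= a u IHu /andP[hd ru]; rewrite IHu //.
by case: u hd {IHu ru} => //= b u /negPf->.
Qed.

Lemma mul_word_cat u1 u2 v :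
  mul_word (u1 ++ u2) v = mul_word u1 (mul_word u2 v).
Proof. by rewrite /mul_word foldr_cat. Qed.

Lemma mul_inv_word u v :
  reduced v -> mul_word (inv_word u) (mul_word u v) = v.
Proof.
move=> rv; elim: u => //= a u IHu.
rewrite /inv_word /= rev_cons -cats1 mul_word_cat /= cons_letterK //.
exact: mul_word_reduced.
Qed.

Lemma inv_wordK : involutive inv_word.
Proof.
move=> u; rewrite /inv_word map_rev revK mapK //; apply: inv_letterK.
Qed.

Lemma reducedP w : reflect
    (forall u a v, w <> u ++ [:: a, inv_letter a & v]) (reduced w).
Proof.
elim: w => [|a w IHw]; first by constructor; case.
case: w IHw => [|b w] IHw; first by constructor; case=> [|? []].
rewrite [reduced _]/= -/(reduced (b :: w)).
apply: (iffP andP) => [[ne /IHw rw] [|c u] d v /= [] |H].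
- by move=> ea eb _; rewrite eb ea eqxx in ne.
- by move=> _; apply: rw.
split; first by apply/eqP => eb; apply: (H [::] a w); rewrite eb.
by apply/IHw => u c v e; apply: (H (a :: u) c v); rewrite e.
Qed.

Lemma inv_word_reduced w : reduced w -> reduced (inv_word w).
Proof.
move=> /reducedP rw; apply/reducedP => u a v.
move/(congr1 inv_word); rewrite inv_wordK {1}/inv_word map_cat rev_cat /=.
by rewrite !rev_cons inv_letterK -!cats1 -!catA; apply: rw.
Qed.

End ReducedWords.

Record free_group (T : choiceType) := FreeGroup {
  word_of : seq (T * bool);
  word_of_reduced : reduced word_of
}.

HB.instance Definition _ (T : choiceType) := [isSub for @word_of T].
HB.instance Definition _ (T : choiceType) := [Choice of free_group T by <:].

Lemma word_of_inj (T : choiceType) : injective (@word_of T).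
Proof. exact: val_inj. Qed.

Section FreeGroupLaws.
Variable T : choiceType.
Implicit Types u v w : free_group T.

Definition fg_one : free_group T := @FreeGroup T [::] isT.
Definition fg_mul u v : free_group T :=
  FreeGroup (mul_word_reduced (word_of u) (word_of_reduced v)).
Definition fg_inv u : free_group T :=
  FreeGroup (inv_word_reduced (word_of_reduced u)).

Lemma fg_mulA : associative fg_mul.
Proof. by move=> u v w; apply/val_inj/mul_wordA; apply: word_of_reduced. Qed.

Lemma fg_mul1 : left_id fg_one fg_mul.
Proof. by move=> u; apply/val_inj. Qed.

Lemma fg_mulr1 : right_id fg_one fg_mul.
Proof. by move=> u; apply/val_inj/mul_word1/word_of_reduced. Qed.

Lemma fg_mulV : left_inverse fg_one fg_inv fg_mul.
Proof.
move=> u; apply/val_inj => /=.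
by rewrite -[X in mul_word _ X](mul_word1 (word_of_reduced u)) mul_inv_word.
Qed.

Lemma fg_mulVr : right_inverse fg_one fg_inv fg_mul.
Proof.
move=> u; rewrite -(fg_mulV (fg_inv u)); congr fg_mul.
by apply/val_inj => /=; rewrite inv_wordK.
Qed.

HB.instance Definition _ :=
  isGroup.Build (free_group T) fg_mulA fg_mul1 fg_mulr1 fg_mulV fg_mulVr.

Definition fg_gen (x : T) : free_group T := @FreeGroup T [:: (x, true)] isT.

End FreeGroupLaws.

Section FreeGroupLift.
Variables (T : choiceType) (H : groupType).
Implicit Types f : T -> H.

Definition letter_val f (a : T * bool) : H := if a.2 then f a.1 else (f a.1)^-1.

Definition fg_lift f (w : free_group T) : H :=
  foldr (fun a h => letter_val f a * h) 1 (word_of w).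

Lemma fg_lift_mul f : {morph fg_lift f : u v / u * v}.
Proof.
move=> [u ru] [v rv]; rewrite /fg_lift /= {ru rv}.
elim: u => [|a u IHu] /=; first by rewrite mul1g.
rewrite -mulgA -IHu; case: (mul_word u v) => [//|b w] /=.
case: (eqVneq b (inv_letter a)) => [->|//].
by case: a => x [] /=; rewrite /letter_val /= ?mulVKg ?mulKg // mulgA mulgV mul1g.
Qed.

HB.instance Definition _ f :=
  isUMagmaMorphism.Build (free_group T) H (fg_lift f)
    (erefl, fg_lift_mul f).

Lemma fg_lift_gen f x : fg_lift f (fg_gen x) = f x.
Proof. by rewrite /fg_lift /= mulg1. Qed.

Lemma fg_lift_unique f (g : hom (free_group T) H) :
  (forall x, g (fg_gen x) = f x) -> g =1 fg_lift f.
Proof.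
move=> gf [w rw]; elim: w rw => [|[x b] w IHw] rw.
  have -> : FreeGroup rw = 1 by apply: word_of_inj.
  by rewrite gmulf1.
have rw' := reduced_behead rw.
pose l := if b then fg_gen x else (fg_gen x)^-1.
have e : FreeGroup rw = l * FreeGroup rw'.
  apply: word_of_inj; rewrite /l; case: b rw {l} => /= /andP[hd _];
  by case: w hd {IHw rw'} => //= c w /negPf ->.
rewrite {1}e gmulfM IHw /l /fg_lift /=.
by case: (b); rewrite ?gmulfV gf.
Qed.

End FreeGroupLift.

Section Logic.
Variable X0 : choiceType.
Implicit Types X Y : {fset X0}.

Definition W X : groupType := free_group X.

Definition point X (H : groupType) := hom (W X) H.

(* X : {fset X0} coerces to the type of its elements, so x : X below is an
   element of the finite set X. *)
Inductive Upsilon : {fset X0} -> Type :=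
| UEq X (w w' : W X) : Upsilon X
| UOr X (u v : Upsilon X) : Upsilon X
| UAnd X (u v : Upsilon X) : Upsilon X
| UNot X (u : Upsilon X) : Upsilon X
| UEx X (x : X) (u : Upsilon X) : Upsilon X
| USubst Y X (s : hom (W Y) (W X)) (u : Upsilon Y) : Upsilon X.

Local Open Scope classical_set_scope.

Section Val.
Variable H : groupType.

Fixpoint Val X (u : Upsilon X) : set (point X H) :=
  match u in Upsilon X return set (point X H) with
  | UEq _ w w' => [set mu | mu w = mu w']
  | UOr _ u v => Val u `|` Val v
  | UAnd _ u v => Val u `&` Val v
  | UNot _ u => ~` Val u
  | UEx X x u => [set mu | exists2 nu : point X H, Val u nu &
      forall x' : X, x' <> x -> mu (fg_gen x') = nu (fg_gen x')]
  | USubst _ X s u => [set mu : point X H | Val u (mu \o s)]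
  end.

End Val.

Arguments Val H [X] u _.

HB.instance Definition _ X := gen_eqMixin (Upsilon X).
HB.instance Definition _ X := gen_choiceMixin (Upsilon X).

Definition same_val X : rel (Upsilon X) :=
  fun u v => `[< forall H : groupType, Val H u = Val H v >].

Lemma same_val_refl X : reflexive (@same_val X).
Proof. by move=> u; apply/asboolP. Qed.

Lemma same_val_sym X : symmetric (@same_val X).
Proof. by move=> u v; apply/asboolP/asboolP => e H; rewrite e. Qed.

Lemma same_val_trans X : transitive (@same_val X).
Proof. by move=> v u w /asboolP e /asboolP e'; apply/asboolP => H; rewrite e. Qed.

Canonical same_val_equiv X :=
  EquivRel (@same_val X)
    (@same_val_refl X) (@same_val_sym X) (@same_val_trans X).

Definition Phi X : choiceType := {eq_quot @same_val X}%qT.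

(* Val on a class is Val of its canonical representative; Val_PhiE shows that
   it does not depend on the representative. *)
Definition Val_Phi (H : groupType) X (u : Phi X) : set (point X H) :=
  Val H (repr u).

Arguments Val_Phi H [X] u _.

Lemma Val_PhiE (H : groupType) X (u : Upsilon X) :
  Val_Phi H (\pi_(Phi X)%qT u) = Val H u.
Proof.
rewrite /Val_Phi; case: piP => v /eqmodP /asboolP e.
by rewrite e.
Qed.

Definition LKer (H : groupType) X (mu : point X H) : set (Phi X) :=
  [set u | Val_Phi H u mu].

Definition logically_perfect (H : groupType) : Prop :=
  forall X (mu nu : point X H),
    LKer mu = LKer nu <->
    exists sigma : hom H H,
      bijective sigma /\ sigma \o mu =1 nu.

End Logic.

(* Main.v *)
Require Import Defs.
From HB Require Import structures.
From mathcomp Require Import all_boot finmap.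
From mathcomp Require Import boolp classical_sets cardinality.

(** The logical kernel of a point [mu] knows which equalities [w = w'] hold at
    [mu], so two points with the same logical kernel have the same kernel as
    homomorphisms. Conversely, an automorphism carrying [mu] to [nu] carries
    [Val u] to itself for every formula [u]. Hence it is enough to embed [G]
    into a group [H] in which any two homomorphisms from a finitely generated
    free group with the same kernel are conjugate: inner automorphisms then
    realize every equality of logical kernels.

    Such an [H] is the union of a chain starting at [G], in which the next term
    conjugates all such pairs of the previous one. The usual way to build the
    next term is an HNN extension. Here permutations are used instead: [G]
    embeds into the permutations of [S = G * seq G] by translating the first
    component. Homomorphisms [mu], [nu] from [W] to [G] with the same kernel [K]
    make [S] a [W]-set in two ways, both of them free as [W / K]-sets, and the
    factor [seq G] is there to give each of the two an
    equivariant injection into the other ([same_kernel_embedding]). By the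
    equivariant form of the Cantor-Bernstein theorem ([equivariant_bernstein])
    the two [W]-sets are isomorphic, and an isomorphism between them is a
    permutation conjugating [mu] to [nu] ([same_kernel_conj]).

    The union is a direct limit of groups ([limit]). Finitely many elements of
    it all come from one stage of the chain ([to_limit_surj]), so both members
    of a pair of homomorphisms from a finitely generated free group factor
    through one stage and become conjugate at the next one
    ([homogeneous_hull_conj]). *)

Set Implicit Arguments.
Unset Strict Implicit.
Unset Printing Implicit Defensive.

Local Open Scope group_scope.

(** * An equivariant Cantor-Bernstein theorem *)

(** The Cantor-Bernstein bijection is [f] on the set [C] of points whose chain
    of alternating preimages under [g] and [f] stops in [U], and the inverse of
    [g] elsewhere. Where a chain stops is not affected by the action, so [C] is
    invariant and the bijection is equivariant as soon as [f] and [g] are. *)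
Lemma equivariant_bernstein (W : groupType) (U V : Type)
    (a : W -> U -> U) (b : W -> V -> V) (f : U -> V) (g : V -> U) :
  (forall w, cancel (a w) (a w^-1)) ->
  injective f -> injective g ->
  (forall w x, f (a w x) = b w (f x)) ->
  (forall w y, g (b w y) = a w (g y)) ->
  exists2 t : U -> V, bijective t & forall w x, t (a w x) = b w (t x).
Proof.
move=> aK f_inj g_inj fE gE.
pose C x := exists n x0, (forall y, g y <> x0) /\ x = iter n (g \o f) x0.
have CS x : C x -> C (g (f x)).
  by case=> n [x0 [x0P ->]]; exists n.+1, x0.
have notC_range x : ~ C x -> exists y, g y = x.
  move=> nCx; apply: contrapT => /forallNP xP.
  by apply: nCx; exists 0, x.
have Cg y : C (g y) -> exists2 x, C x & f x = y.
  case=> -[|n] [x0 [x0P]] => [/x0P //|] /= /g_inj ->.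
  by exists (iter n (g \o f) x0) => //; exists n, x0.
have Ca w x : C x -> C (a w x).
  case=> n [x0 [x0P ->]]; exists n, (a w x0); split.
    by move=> y gy; apply: (x0P (b w^-1 y)); rewrite gE gy aK.
  by elim: n => //= n <-; rewrite fE gE.
have tP x : exists y, (C x /\ y = f x) \/ (~ C x /\ g y = x).
  have [Cx|nCx] := pselect (C x); first by exists (f x); left.
  by have [y gy] := notC_range _ nCx; exists y; right.
have [t {}tP] := choice tP.
have t_inj : injective t.
  move=> x x' e.
  case: (tP x) (tP x') => [[Cx tx]|[nCx tx]] [[Cx' tx']|[nCx' tx']].
  - by apply: f_inj; rewrite -tx -tx'.
  - by case: nCx'; rewrite -tx' -e tx; apply: CS.
  - by case: nCx; rewrite -tx e tx'; apply: CS.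
  - by rewrite -tx -tx' e.
have t_surj y : exists x, t x = y.
  have [/Cg[x Cx <-]|nC] := pselect (C (g y)).
    by exists x; case: (tP x) => -[].
  by exists (g y); case: (tP (g y)) => -[// _ /g_inj].
have [t' t'K] := choice t_surj.
exists t; first by exists t' => // x; apply: t_inj; rewrite t'K.
move=> w x; case: (tP x) (tP (a w x)) => -[Cx tx] [] [Cax tax].
- by rewrite tax tx fE.
- by case: Cax; apply: Ca.
- by case: Cx; rewrite -(aK w x); apply: Ca.
- by apply: g_inj; rewrite tax gE tx.
Qed.

(** * The group of permutations of a type *)

(** Carrying the inverse as data makes inversion the exchange of two fields;
    the inverse being unique, equality is still decided by [perm_fun]. *)
Record permutation (S : Type) := Permutation {
  perm_fun :> S -> S;
  perm_inv : S -> S;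
  perm_funK : cancel perm_fun perm_inv;
  perm_invK : cancel perm_inv perm_fun
}.

Section PermutationGroup.
Variable S : Type.
Implicit Types p q r : permutation S.

Lemma permutation_eq p q : p =1 q -> p = q.
Proof.
case: p q => [f f' fK f'K] [g g' gK g'K] /= fg.
have {}fg := funext fg; case: g / fg gK g'K => gK g'K.
have fg' : f' = g' by apply: funext => x; rewrite -{1}(g'K x) fK.
case: g' / fg' gK g'K => gK g'K.
by rewrite (Prop_irrelevance fK gK) (Prop_irrelevance f'K g'K).
Qed.

Definition perm_one := @Permutation S id id (frefl _) (frefl _).
Definition perm_mul p q :=
  Permutation (can_comp (perm_funK p) (perm_funK q))
    (can_comp (perm_invK q) (perm_invK p)).
Definition perm_opp p := Permutation (perm_invK p) (perm_funK p).

Lemma perm_mulA : associative perm_mul.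
Proof. by move=> p q r; apply: permutation_eq. Qed.
Lemma perm_mul1 : left_id perm_one perm_mul.
Proof. by move=> p; apply: permutation_eq. Qed.
Lemma perm_mulr1 : right_id perm_one perm_mul.
Proof. by move=> p; apply: permutation_eq. Qed.
Lemma perm_mulV : left_inverse perm_one perm_opp perm_mul.
Proof. by move=> p; apply/permutation_eq/perm_funK. Qed.
Lemma perm_mulrV : right_inverse perm_one perm_opp perm_mul.
Proof. by move=> p; apply/permutation_eq/perm_invK. Qed.

HB.instance Definition _ := gen_eqMixin (permutation S).
HB.instance Definition _ := gen_choiceMixin (permutation S).
HB.instance Definition _ := isGroup.Build (permutation S)
  perm_mulA perm_mul1 perm_mulr1 perm_mulV perm_mulrV.

End PermutationGroup.

(** * Conjugating homomorphisms with the same kernel *)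

Definition same_kernel (W G : groupType) (mu nu : hom W G) :=
  forall w w', mu w = mu w' <-> nu w = nu w'.

Section Translations.
Variable G : groupType.

Definition translate (g : G) (p : G * seq G) : G * seq G := (g * p.1, p.2).

Lemma translateK g : cancel (translate g) (translate g^-1).
Proof. by case=> h s; rewrite /translate /= mulKg. Qed.

Lemma translateVK g : cancel (translate g^-1) (translate g).
Proof. by case=> h s; rewrite /translate /= mulVKg. Qed.

(** The list component provides enough orbits: on [G] alone, two isomorphic
    subgroups may have different indices and then no permutation conjugates one
    to the other. *)
Definition conjugator_group : groupType := permutation (G * seq G).

Definition translation (g : G) : conjugator_group :=
  Permutation (translateK g) (translateVK g).

Lemma translationM : {morph translation : g h / g * h}.
Proof.
by move=> g h; apply: permutation_eq => -[k s]; rewrite /= /translate /= mulgA.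
Qed.

Lemma translation1 : translation 1 = 1.
Proof.
by apply: permutation_eq => -[k s]; rewrite /= /translate /= mul1g.
Qed.

HB.instance Definition _ :=
  isUMagmaMorphism.Build G conjugator_group translation
    (translation1, translationM).

Lemma translation_inj : injective translation.
Proof.
move=> g h /(congr1 (fun p : permutation _ => p (1, [::]))).
by rewrite /= /translate /= !mulg1 => -[].
Qed.

(** The orbits of [W] acting through [mu] are of the form [mu W * r], times a
    second component. Sending [(mu w * r, s)] to [(nu w, r :: s)] is well
    defined on each orbit since [mu] and [nu] have the same kernel, and it
    stores the representative [r] in the list, which makes it injective. *)
Lemma same_kernel_embedding (W : groupType) (mu nu : hom W G) :
  same_kernel mu nu ->
  exists2 f : G * seq G -> G * seq G, injective f &
    forall w p, f (translate (mu w) p) = translate (nu w) (f p).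
Proof.
move=> munu.
pose rep g := xget 1 [set r | exists w, g = mu w * r]%classic.
have repP g : exists w, g = mu w * rep g.
  by apply: (@xgetPex _ _ [set r | exists w, g = mu w * r]%classic);
    exists g, 1; rewrite gmulf1 mul1g.
have rep_translate w g : rep (mu w * g) = rep g.
  (* The representative depends only on the orbit, seen as a set. *)
  congr xget; apply/seteqP; split=> r /= [v e].
    by exists (w^-1 * v); rewrite gmulfM -mulgA -e gmulfV mulKg.
  by exists (w * v); rewrite gmulfM -mulgA -e.
have [c cP] := choice repP.
exists (fun p => (nu (c p.1), rep p.1 :: p.2)).
  move=> [g s] [g' s'] /= [] /munu e r ->.
  by rewrite (cP g) (cP g') e r.
move=> w [g s]; rewrite /translate /= rep_translate; congr (_, _).
rewrite -gmulfM; apply/munu; rewrite gmulfM.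
apply: (mulIg (rep g)); rewrite -mulgA -cP.
by rewrite -[X in _ * X](rep_translate w) -cP.
Qed.

Lemma same_kernel_conj (W : groupType) (mu nu : hom W G) :
  same_kernel mu nu ->
  exists h, forall w, conjg (translation (mu w)) h = translation (nu w).
Proof.
move=> munu.
have [f f_inj fE] := same_kernel_embedding munu.
have [g g_inj gE] := same_kernel_embedding
  (fun w w' => iff_sym (munu w w') : _ <-> _).
(* Since [conjg x h] is [h^-1 * x * h], the permutation to be found carries
   the action through [nu] to the action through [mu]. *)
have [w|t [t' tK t'K] tE] := equivariant_bernstein
  (a := fun w => translate (nu w)) (b := fun w => translate (mu w)) _ g_inj
  f_inj gE fE.
  by rewrite gmulfV; apply: translateK.
exists (Permutation tK t'K) => w.
rewrite conjgE; apply: (canLR (mulKg _)).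
by apply: permutation_eq => p; rewrite /= tE.
Qed.

End Translations.

(** * Direct limits along the natural numbers *)

Section DirectLimit.
Variables (G : nat -> groupType) (i : forall n, hom (G n) (G n.+1)).

Definition coherent_from n (f : forall m, G m) :=
  forall m, (n <= m)%N -> f m.+1 = i m (f m).

(** An element of the limit is a sequence that ends up following the maps [i],
    up to equality at all large indices. Transport between the groups [G n] is
    thereby confined to [at_stage]. *)
Record thread := Thread {
  thread_val :> forall n, G n;
  thread_coherent : exists n, coherent_from n thread_val
}.

HB.instance Definition _ := gen_eqMixin thread.
HB.instance Definition _ := gen_choiceMixin thread.

Definition eventually_eq : rel thread :=
  fun f g => `[< exists n, forall m, (n <= m)%N -> f m = g m >].

Lemma eventually_eq_refl : reflexive eventually_eq.
Proof. by move=> f; apply/asboolP; exists 0. Qed.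

Lemma eventually_eq_sym : symmetric eventually_eq.
Proof.
by move=> f g; apply/asboolP/asboolP => -[n fg]; exists n => m /fg.
Qed.

Lemma eventually_eq_trans : transitive eventually_eq.
Proof.
move=> g f h /asboolP[n fg] /asboolP[n' gh]; apply/asboolP.
by exists (maxn n n') => m; rewrite geq_max => /andP[/fg -> /gh].
Qed.

Canonical eventually_eq_equiv := EquivRel eventually_eq
  eventually_eq_refl eventually_eq_sym eventually_eq_trans.

Definition limit : Type := {eq_quot eventually_eq}%qT.
HB.instance Definition _ := Choice.on limit.
HB.instance Definition _ := EqQuotient.on limit.

Definition germ (f : thread) : limit := \pi_limit%qT f.

Lemma germP f g :
  germ f = germ g <-> exists n, forall m, (n <= m)%N -> f m = g m.
Proof.
by rewrite /germ; split=> [/eqmodP/asboolP|?]; last apply/eqmodP/asboolP.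
Qed.

Lemma germ_surj z : exists f, z = germ f.
Proof. by exists (repr z); rewrite /germ reprK. Qed.

Lemma thread_one_coherent : exists n, coherent_from n (fun n => 1 : G n).
Proof. by exists 0 => m _; rewrite gmulf1. Qed.
Lemma thread_mul_coherent (f g : thread) :
  exists n, coherent_from n (fun n => f n * g n).
Proof.
case: (thread_coherent f) (thread_coherent g) => [n fP] [n' gP].
exists (maxn n n') => m; rewrite geq_max => /andP[/fP -> /gP ->].
by rewrite gmulfM.
Qed.
Lemma thread_inv_coherent (f : thread) :
  exists n, coherent_from n (fun n => (f n)^-1).
Proof.
by case: (thread_coherent f) => [n fP]; exists n => m /fP ->; rewrite gmulfV.
Qed.

Definition limit_one := germ (Thread thread_one_coherent).
Definition limit_mul (x y : limit) : limit :=
  germ (Thread (thread_mul_coherent (repr x) (repr y))).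
Definition limit_inv (x : limit) : limit :=
  germ (Thread (thread_inv_coherent (repr x))).

Lemma repr_germ f : exists n, forall m, (n <= m)%N -> repr (germ f) m = f m.
Proof. by apply/germP; rewrite /germ reprK. Qed.

Lemma germM f g :
  limit_mul (germ f) (germ g) = germ (Thread (thread_mul_coherent f g)).
Proof.
have [n fP] := repr_germ f; have [n' gP] := repr_germ g.
apply/germP; exists (maxn n n') => m /=.
by rewrite geq_max => /andP[/fP -> /gP ->].
Qed.

Lemma germV f : limit_inv (germ f) = germ (Thread (thread_inv_coherent f)).
Proof.
by have [n fP] := repr_germ f; apply/germP; exists n => m /= /fP ->.
Qed.

Lemma limit_mulA : associative limit_mul.
Proof.
move=> x y z.
case: (germ_surj x) (germ_surj y) (germ_surj z) => f -> [g ->] [h ->].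
by rewrite !germM; apply/germP; exists 0 => m _ /=; rewrite mulgA.
Qed.
Lemma limit_mul1 : left_id limit_one limit_mul.
Proof.
move=> x; case: (germ_surj x) => f ->; rewrite germM.
by apply/germP; exists 0 => m _ /=; rewrite mul1g.
Qed.
Lemma limit_mulr1 : right_id limit_one limit_mul.
Proof.
move=> x; case: (germ_surj x) => f ->; rewrite germM.
by apply/germP; exists 0 => m _ /=; rewrite mulg1.
Qed.
Lemma limit_mulV : left_inverse limit_one limit_inv limit_mul.
Proof.
move=> x; case: (germ_surj x) => f ->; rewrite germV germM.
by apply/germP; exists 0 => m _ /=; rewrite mulVg.
Qed.
Lemma limit_mulrV : right_inverse limit_one limit_inv limit_mul.
Proof.
move=> x; case: (germ_surj x) => f ->; rewrite germV germM.
by apply/germP; exists 0 => m _ /=; rewrite mulgV.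
Qed.

HB.instance Definition _ := isGroup.Build limit
  limit_mulA limit_mul1 limit_mulr1 limit_mulV limit_mulrV.

(** The thread of [x : G n] is [1] below [n] and follows [i] from [n] on. *)
Definition at_stage n (x : G n) m : G m :=
  if n =P m is ReflectT e then ecast k (G k) e x else 1.

Fixpoint push n (x : G n) m : G m :=
  if m is m'.+1 then
    if (n <= m')%N then i m' (push x m') else at_stage x m'.+1
  else at_stage x 0.

Lemma push_stage n (x : G n) : push x n = x.
Proof.
have atx : at_stage x n = x.
  by rewrite /at_stage; case: eqP => // e; rewrite eq_axiomK.
by case: n x atx => [|n] x atx //=; rewrite ltnn.
Qed.

Lemma push_coherent_from n (x : G n) : coherent_from n (push x).
Proof. by move=> m /= ->. Qed.

Lemma push_coherent n (x : G n) : exists k, coherent_from k (push x).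
Proof. by exists n; apply: push_coherent_from. Qed.

(** The reason why a germ is determined by the value of a thread at any single
    stage from which that thread is coherent. *)
Lemma coherent_from_eq n (f g : forall m, G m) :
  coherent_from n f -> coherent_from n g -> f n = g n ->
  forall m, (n <= m)%N -> f m = g m.
Proof.
move=> fP gP fg; elim=> [|m IHm]; first by rewrite leqn0 => /eqP <-.
rewrite leq_eqVlt => /predU1P[<- //|lt_nm].
by rewrite fP // gP // IHm.
Qed.

Definition to_limit n (x : G n) : limit := germ (Thread (push_coherent x)).

Lemma germ_to_limit (f : thread) n :
  coherent_from n f -> germ f = to_limit (f n).
Proof.
move=> fP; apply/germP; exists n => m; apply: coherent_from_eq => //=.
  exact: push_coherent_from.
by rewrite push_stage.
Qed.

Lemma to_limit1 n : to_limit (1 : G n) = 1.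
Proof. by apply/esym; apply: germ_to_limit => m _ /=; rewrite gmulf1. Qed.

Lemma to_limitM n : {morph @to_limit n : x y / x * y}.
Proof.
move=> x y; apply/esym.
rewrite [LHS]germM (@germ_to_limit _ n) /= ?push_stage //.
by move=> m nm; rewrite /= nm gmulfM.
Qed.

HB.instance Definition _ n := isUMagmaMorphism.Build (G n) limit (@to_limit n)
  (@to_limit1 n, @to_limitM n).

Lemma to_limitS n (x : G n) : to_limit (i n x) = to_limit x.
Proof.
apply/esym; rewrite /to_limit (@germ_to_limit _ n.+1) /= ?leqnn ?push_stage //.
by move=> m nm; rewrite /= (ltnW nm).
Qed.

Lemma to_limit_inj :
  (forall n, injective (i n)) -> forall n, injective (@to_limit n).
Proof.
move=> i_inj n x y /germP[k /= /(_ (n + k)%N (leq_addl _ _))].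
elim: k => [|k IHk]; first by rewrite addn0 !push_stage.
by rewrite addnS /= leq_addr => /i_inj.
Qed.

Lemma to_limit_surj (I : finType) (z : I -> limit) :
  exists n (y : I -> G n), forall x, z x = to_limit (y x).
Proof.
have /choice[f zP] x : exists f, z x = germ f by apply: germ_surj.
have /choice[k kP] x : exists k, coherent_from k (f x).
  exact: thread_coherent.
exists (\max_x k x)%N, (fun x => f x (\max_x k x)%N) => x; rewrite zP.
apply: germ_to_limit => m le_m; apply: kP.
by apply: leq_trans le_m; apply: leq_bigmax.
Qed.

End DirectLimit.

(** * Homogeneous groups *)

Lemma fg_hom_eq (T : choiceType) (H : groupType) (f g : hom (free_group T) H) :
  (forall x, f (fg_gen x) = g (fg_gen x)) -> f =1 g.
Proof.
move=> fg w; rewrite (fg_lift_unique fg).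
by rewrite -(@fg_lift_unique _ _ _ g).
Qed.

Fixpoint tower (G : groupType) n : groupType :=
  if n is m.+1 then conjugator_group (tower G m) else G.

Definition tower_step (G : groupType) n : hom (tower G n) (tower G n.+1) :=
  @translation (tower G n).

Definition homogeneous_hull (G : groupType) : groupType :=
  limit (tower_step G).

Definition hull_embedding (G : groupType) n :
    hom (tower G n) (homogeneous_hull G) :=
  @to_limit _ (tower_step G) n.

Lemma hull_embedding_inj (G : groupType) n : injective (@hull_embedding G n).
Proof. by apply: to_limit_inj => m; apply: translation_inj. Qed.

(** Finiteness of [T] puts the images of the generators under [mu] and [nu] at
    one stage of the tower; freeness then defines [mu'] and [nu'] there. They
    have the same kernel because the stages embed into the limit. *)
Lemma homogeneous_hull_conj (G : groupType) (T : finType)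
    (mu nu : hom (free_group T) (homogeneous_hull G)) :
  same_kernel mu nu -> exists h, forall w, conjg (mu w) h = nu w.
Proof.
move=> munu.
pose z (x : T + T) := match x with
  inl x => mu (fg_gen x) | inr x => nu (fg_gen x) end.
have [n [y zE]] := to_limit_surj z.
pose mu' : hom (free_group T) (tower G n) := fg_lift (y \o inl).
pose nu' : hom (free_group T) (tower G n) := fg_lift (y \o inr).
have muE : mu =1 hull_embedding G n \o mu'.
  by apply: fg_hom_eq => x /=; rewrite fg_lift_gen -zE.
have nuE : nu =1 hull_embedding G n \o nu'.
  by apply: fg_hom_eq => x /=; rewrite fg_lift_gen -zE.
have [w w'|h hP] := @same_kernel_conj _ _ mu' nu'.
  have := munu w w'; rewrite !muE !nuE /= => -[mn nm].
  by split=> e; apply: (@hull_embedding_inj G n); [apply: mn | apply: nm];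
    rewrite e.
(* Conjugation by an element of stage [n.+1] requires both sides there. *)
have embS x : hull_embedding G n.+1 (translation x) = hull_embedding G n x.
  exact: to_limitS.
exists (hull_embedding G n.+1 h) => w.
by rewrite muE nuE /= -(embS (mu' w)) -gmulfJ hP embS.
Qed.

(** * Logical kernels *)

Section LogicalKernels.
Variables (X0 : choiceType) (H : groupType).
Implicit Types X : {fset X0}.

Lemma LKer_same_kernel X (mu nu : Defs.point X H) :
  LKer mu = LKer nu -> same_kernel mu nu.
Proof.
move=> e w w'.
have := congr1 (fun L => L (\pi_(Phi X)%qT (UEq w w'))) e.
by rewrite /LKer /= !Val_PhiE /= => ->.
Qed.

(** The induction covers every pair of points related by [sigma] at once: the
    quantifier changes the points, and the substitution changes [X]. The
    inverse [tau] brings the witnesses of an existential formula back. *)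
Lemma Val_automorphism X (u : Upsilon X) (sigma tau : hom H H) :
  cancel sigma tau -> cancel tau sigma ->
  forall mu nu : Defs.point X H, sigma \o mu =1 nu -> Val u mu <-> Val u nu.
Proof.
move=> st ts.
elim: u => {X} [X w w'|X u IHu v IHv|X u IHu v IHv|X u IHu|X x u IHu
  |Y X s u IHu] mu nu munu /=.
- by rewrite -!munu /=; split=> [->//|/(can_inj st)].
- by rewrite /setU /= (IHu _ _ munu) (IHv _ _ munu).
- by rewrite /setI /= (IHu _ _ munu) (IHv _ _ munu).
- by rewrite /setC /= (IHu _ _ munu).
- split=> -[pi up eqp].
    exists (sigma \o pi); first by apply/(IHu pi).
    by move=> x' /eqp /= <-; rewrite -munu.
  exists (tau \o pi); first by apply/(IHu _ pi) => // y /=; rewrite ts.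
  by move=> x' /eqp /= <-; rewrite -munu /= st.
- by apply: IHu => y /=; rewrite -munu.
Qed.

Lemma automorphism_LKer X (sigma : hom H H) (mu nu : Defs.point X H) :
  bijective sigma -> sigma \o mu =1 nu -> LKer mu = LKer nu.
Proof.
move=> [t st ts] munu.
pose tM := isUMagmaMorphism.Build H H t (can2_gmulf1 st ts, can2_gmulfM st ts).
pose tau : hom H H := HB.pack t tM.
apply/seteqP.
by split=> u; apply (Val_automorphism (repr u) st (tau := tau) ts munu).
Qed.

End LogicalKernels.

Section InnerAutomorphisms.
Variables (H : groupType) (h : H).

Definition inner (x : H) := conjg x h.

Lemma innerM : {morph inner : x y / x * y}.
Proof. by move=> x y; apply: conjMg. Qed.

HB.instance Definition _ :=
  isUMagmaMorphism.Build H H inner (conj1g h, innerM).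

Lemma inner_bij : bijective inner.
Proof.
by exists (fun x => conjg x h^-1) => x; [apply: conjgK | apply: conjgKV].
Qed.

End InnerAutomorphisms.

Theorem theorem4p6 (X0 : choiceType)
    (X0_infinite : infinite_set [set: X0]%classic) (G : groupType) :
  exists H : groupType,
    (exists f : hom G H, injective f) /\ logically_perfect X0 H.
Proof.
exists (homogeneous_hull G); split.
  by exists (hull_embedding G 0); apply: (@hull_embedding_inj G 0).
move=> X mu nu; split=> [/LKer_same_kernel /homogeneous_hull_conj[h hP]|].
  by exists (inner h : hom _ _); split; [apply: inner_bij | apply: hP].
by move=> [sigma [sigma_bij sigmaP]]; apply: automorphism_LKer sigmaP.
Qed.
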